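(* If $\Gamma$ is a shellable simplicial complex of dimension $d$, then the $i$-facet skeleton $\Gamma^{[i]}$ is shellable for all $i\le d$. In particular, if $\Gamma$ is pure, then any skeleton of $\Gamma$ is again shellable.
   Context: Simplicial complexes are finite. Shellable means (possibly non-pure) shellable in the sense of Björner and Wachs: the facets can be ordered $F_1,\ldots,F_m$ such that for each $k=2,\ldots,m$ the complex $\langle F_1,\ldots,F_{k-1}\rangle\cap\langle F_k\rangle$ is pure of dimension $\dim F_k-1$. Here $\langle\cdots\rangle$ denotes the simplicial complex generated by the listed faces, and $\mathcal F(\Delta)$ denotes the set of facets of $\Delta$. For a simplicial complex $\Delta$ of dimension $d$, the $1$-facet skeleton is $\Delta^{[1]}=\langle G : G\subset F\in\mathcal F(\Delta)\text{ and }|G|=|F|-1\rangle$. Recursively, for $i=1,\ldots,d$, the $i$-facet skeleton $\Delta^{[i]}$ is the $1$-facet skeleton of $\Delta^{[i-1]}$, where $\Delta^{[0]}=\Delta$. (If $\Delta$ is pure of dimension $d$, then $\Delta^{[i]}$ is the usual $(d-i)$-skeleton of $\Delta$.) *)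

(* Defs.v *)
From HB Require Import structures.
From mathcomp Require Import all_boot all_order all_algebra.

Set Implicit Arguments.
Unset Strict Implicit.
Unset Printing Implicit Defensive.

Import Order.TTheory GRing.Theory Num.Theory.
Local Open Scope ring_scope.

(* Simplicial complexes are families of subsets of a finite type V.  The
   points of V need not all be vertices, so that a complex, its skeletons and
   its facet skeletons live over the same V. *)
Section SimplicialComplexes.
Variable V : finType.
Implicit Types (D S : {set {set V}}) (F G : {set V}) (s : seq {set V}).

Definition simplicial_complex D : bool :=
  (set0 \in D) && [forall F in D, powerset F \subset D].

(* Integer-valued, since the empty face has dimension -1. *)
Definition face_dim F : int := #|F|%:Z - 1.

(* For D nonempty this is the maximum of face_dim over D. *)
Definition complex_dim D : int := (\max_(F in D) #|F|)%N%:Z - 1.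

Definition facets D : {set {set V}} := [set F : {set V} | maxset [in D] F].

Definition generated_complex S : {set {set V}} :=
  [set G : {set V} | [exists F in S, G \subset F]].

Definition pure_complex D : bool :=
  [forall F in facets D, face_dim F == complex_dim D].

(* s = [:: F_1; ...; F_m]; the face nth set0 s k is F_{k+1} and take k s lists
   F_1, ..., F_k. *)
Definition shelling D s : Prop :=
  [/\ uniq s, s =i facets D &
      forall k : nat, (0 < k < size s)%N ->
        let F := nth set0 s k in
        let I := generated_complex [set G in take k s]
                 :&: generated_complex [set F] in
        pure_complex I /\ complex_dim I = face_dim F - 1].

Definition shellable D : Prop := exists s, shelling D s.

(* #|G|.+1 = #|F| avoids truncated subtraction when F is empty. *)
Definition one_facet_skeleton D : {set {set V}} :=
  generated_complex
    [set G : {set V} |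
      [exists F in facets D, (G \subset F) && (#|G|.+1 == #|F|)]].

Definition facet_skeleton (i : nat) D : {set {set V}} :=
  iter i one_facet_skeleton D.

Definition skeleton (j : int) D : {set {set V}} :=
  [set F in D | face_dim F <= j].

End SimplicialComplexes.

(* Main.v *)
(* In a list of faces, F attaches to the previous ones when every previous G
   misses a vertex v of F such that F \ v lies in a previous face; this is the
   condition in the definition of a shelling.  A shelling can be rearranged
   so that the sizes of the facets do not increase (Bjorner and Wachs).  Replacing then every facet by the list of its ridges
   gives a shelling of the 1-facet skeleton, up to ridges contained in a
   previous one; thanks to the decreasing sizes these are exactly the
   non-maximal or repeated ones, and they can be dropped.  For a pure complex
   of dimension > j, the j-skeleton is the 1-facet skeleton of the
   (j+1)-skeleton. *)
Require Import Defs.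
From mathcomp Require Import all_boot all_order all_algebra.
From mathcomp Require Import zify.
Import Order.TTheory GRing.Theory Num.Theory.
Local Open Scope ring_scope.

Set Implicit Arguments.
Unset Strict Implicit.
Unset Printing Implicit Defensive.

Section FacetSkeletons.
Variable V : finType.
Implicit Types (D S : {set {set V}}) (F G H K M : {set V}) (s t L : seq {set V}).

(** * Attachment of a face to earlier faces *)

Definition attaches t F : Prop :=
  forall G, G \in t ->
    exists2 v, v \in F :\: G & exists2 H, H \in t & F :\ v \subset H.

Lemma attaches_notin t F G : attaches t F -> G \in t -> ~~ (F \subset G).
Proof.
move=> tF Gt; have [v] := tF G Gt; rewrite inE => /andP[vG vF] _.
by apply/negP => /subsetP /(_ v vF); apply/negP.
Qed.

Lemma card_setD1 F (v : V) : v \in F -> #|F :\ v|.+1 = #|F|.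
Proof. by move=> vF; rewrite (cardsD1 v F) vF. Qed.

Lemma setD1_of_card F G :
  G \subset F -> #|G|.+1 = #|F| -> exists2 v, v \in F & G = F :\ v.
Proof.
move=> sGF cG.
have /properP[_ [v vF vG]] : G \proper F by rewrite properEcard sGF -cG ltnSn.
exists v => //; apply/eqP; rewrite eqEcard subsetD1 sGF vG /=.
by rewrite -ltnS (card_setD1 vF) cG.
Qed.

Lemma facetsP D F :
  reflect (F \in D /\ forall G, G \in D -> F \subset G -> G = F)
          (F \in facets D).
Proof. by rewrite inE; exact: maxsetP. Qed.

Lemma facet_exists D G :
  G \in D -> exists2 F, F \in facets D & G \subset F.
Proof.
move=> GD; have [F mF sGF] := @maxset_exists _ (fun F => F \in D) G GD.
by exists F => //; rewrite inE.
Qed.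

Lemma generatedP S G :
  reflect (exists2 F, F \in S & G \subset F) (G \in generated_complex S).
Proof. by rewrite inE; exact: exists_inP. Qed.

Lemma mem_attachment t F M :
  reflect (M \subset F /\ exists2 G, G \in t & M \subset G)
   (M \in generated_complex [set G in t] :&: generated_complex [set F]).
Proof.
apply: (iffP setIP) => [[/generatedP[G + sMG] /generatedP[F' /set1P-> sMF]]|].
  by rewrite inE => Gt; split=> //; exists G.
move=> [sMF [G Gt sMG]]; split; apply/generatedP; last by exists F; rewrite ?inE.
by exists G; rewrite ?inE.
Qed.

(** A facet of [I] above [G :&: F] is a ridge [F :\ v], and [G :&: F \subset F :\ v] with [v] in [F]
    forces [v] out of [G]. Conversely, every face of [I] lies in such a ridge, and all ridges of [F]
    have the same size. *)
Lemma attachesP t F (I := generated_complex [set G in t]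
                            :&: generated_complex [set F]) :
    t != [::] ->
  pure_complex I /\ complex_dim I = face_dim F - 1 <-> attaches t F.
Proof.
move=> t_n0; split=> [[/forall_inP pI dI] G Gt|tF].
  have /facet_exists[M fM] : G :&: F \in I.
    by apply/mem_attachment; rewrite subsetIr; split=> //; exists G; rewrite ?subsetIl.
  move: (pI M fM); rewrite dI /face_dim => /eqP cM.
  have /facetsP[/mem_attachment[sMF [H Ht sMH]] _] := fM.
  have [|v vF eM] := setD1_of_card sMF; first by lia.
  rewrite eM subsetD1 !inE vF andbT => /andP[_ vG].
  by exists v; [rewrite inE vF andbT | exists H; rewrite -?eM].
have below K : K \in I ->
    exists2 v, v \in F & F :\ v \in I /\ K \subset F :\ v.
  move=> /mem_attachment[sKF [G Gt sKG]].
  have [v + [H Ht sFH]] := tF G Gt; rewrite inE => /andP[vG vF].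
  exists v => //; split; first by apply/mem_attachment; rewrite subD1set; split=> //; exists H.
  by rewrite subsetD1 sKF; apply: contra vG => /(subsetP sKG).
have dI : complex_dim I = face_dim F - 1.
  (* As [t] is nonempty, [set0] lies in [I], so [below] gives a ridge attaining the maximum; for
     empty [t] the maximum would default to 0. *)
  case: t t_n0 {tF} @I below => // G t _ I below.
  have /below[v vF [vI _]] : set0 \in I.
    apply/mem_attachment; split; first exact: sub0set.
    by exists G; rewrite ?mem_head ?sub0set.
  rewrite /complex_dim /face_dim.
  suff -> : (\max_(K in I) #|K| = #|F :\ v|)%N by rewrite -(card_setD1 vF); lia.
  apply/eqP; rewrite eqn_leq; apply/andP; split; last exact: leq_bigmax_cond.
  apply/bigmax_leqP => K /below[u uF [_ /subset_leq_card]].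
  by have := card_setD1 uF; have := card_setD1 vF; lia.
split=> //; apply/forall_inP => M /facetsP[/below[v vF [vI sMv]] maxM].
by rewrite dI -(maxM _ vI sMv) /face_dim -(card_setD1 vF); apply/eqP; lia.
Qed.

(** * Shellings as reversed lists of faces *)

(* The faces are listed in reverse order, so that the head is added last. *)
Fixpoint shelled t : Prop :=
  if t is F :: t' then attaches t' F /\ shelled t' else True.

Fixpoint sorted_shelled t : Prop :=
  if t is F :: t' then
    [/\ forall G, G \in t' -> (#|F| <= #|G|)%N, attaches t' F
      & sorted_shelled t']
  else True.

(* Faces contained in a previous one are allowed. *)
Fixpoint weakly_shelled t : Prop :=
  if t is F :: t' then
    [/\ forall G, G \in t' -> (#|F| <= #|G|)%N,
        (exists2 G, G \in t' & F \subset G) \/ attaches t' F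
      & weakly_shelled t']
  else True.

Lemma shelled_rev s :
  shelled (rev s) <->
  forall k, (k < size s)%N -> attaches (take k s) (nth set0 s k).
Proof.
have attaches_rev r F : attaches (rev r) F <-> attaches r F.
  split=> rF G; have := rF G; rewrite ?mem_rev => rFG Gr;
  by have [v vFG [H Hr sFH]] := rFG Gr; exists v => //; exists H; rewrite // ?mem_rev // -mem_rev.
elim/last_ind: s => [|s F IHs]; first by split.
rewrite rev_rcons /= size_rcons; split=> [[/attaches_rev sF /IHs ss] k|ss].
  rewrite ltnS leq_eqVlt => /predU1P[->|lt_ks].
    by rewrite nth_rcons ltnn eqxx -cats1 take_size_cat.
  by rewrite nth_rcons lt_ks -cats1 takel_cat ?(ltnW lt_ks) //; exact: ss.
split.
  have := ss (size s) (ltnSn _).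
  by rewrite nth_rcons ltnn eqxx -cats1 take_size_cat // => /attaches_rev.
apply/IHs => k lt_ks; have := ss k (ltnW lt_ks).
by rewrite nth_rcons lt_ks -cats1 takel_cat // ltnW.
Qed.

Lemma shelled_uniq t : shelled t -> uniq t.
Proof.
elim: t => //= F t IHt [tF /IHt ->]; rewrite andbT; apply/negP => Ft.
by have := attaches_notin tF Ft; rewrite subxx.
Qed.

(** Attachment to the empty list is vacuous, so the first facet needs no separate case; distinctness
    is automatic, since a face never attaches to a list containing it. *)
Lemma shellableP D : shellable D <-> exists2 t, shelled t & t =i facets D.
Proof.
split=> [[s [us sD sh]]|[t sh tD]].
  exists (rev s); last by move=> F; rewrite mem_rev.
  apply/shelled_rev => -[|k] lt_ks; first by rewrite take0.
  by apply/attachesP; [case: s lt_ks {us sD sh} | exact: (sh k.+1)].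
exists (rev t); split; first by rewrite rev_uniq shelled_uniq.
  by move=> F; rewrite mem_rev.
move=> k /andP[k_gt0 lt_kt] F I; apply/attachesP.
  by rewrite -size_eq0 size_take lt_kt -lt0n.
by move: k lt_kt {k_gt0} @F @I; apply/shelled_rev; rewrite revK.
Qed.

(** * Rearrangement by non-increasing size *)

(* The new face [F] also precedes the smaller faces [G] of [t]; if
   [F :\ v \subset H] with [v] outside [G], then [H] already precedes [G] and
   [G :&: F \subset G :&: H], so [G] still attaches. *)
Lemma sorted_shelled_insert t F :
    sorted_shelled t -> attaches t F -> (forall G, G \in t -> ~~ (G \subset F)) ->
  exists2 t', sorted_shelled t' & t' =i F :: t.
Proof.
elim: t => [|G t IHt] /=; first by move=> _ _ _; exists [:: F].
move=> [Gt tG sht] GtF antiF; have [leFG|ltGF] := leqP #|F| #|G|.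
  exists (F :: G :: t) => //; split=> // K; rewrite inE => /predU1P[-> //|/Gt].
  exact: leq_trans.
(* The witness cannot be [G] itself: [G] is smaller than [F], so [F :\ v \subset G] would give
   [F :\ v = G], against [antiF]. *)
have {}GtF K : K \in G :: t ->
    exists2 v, v \in F :\: K & exists2 H, H \in t & F :\ v \subset H.
  move=> /GtF[v vFK [H + sFH]]; rewrite inE => /predU1P[eH|Ht]; last first.
    by exists v => //; exists H.
  have vF : v \in F by move: vFK; rewrite inE => /andP[].
  suff /eqP eG : F :\ v == G by have := antiF G (mem_head _ _); rewrite -eG subD1set.
  by rewrite eqEcard -{1}eH sFH -ltnS (card_setD1 vF).
have tF : attaches t F by move=> K Kt; apply: GtF; rewrite inE Kt orbT.
have [|t' sht' et'] := IHt sht tF.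
  by move=> K Kt; apply: antiF; rewrite inE Kt orbT.
have sub_t' K : K \in t -> K \in t' by rewrite et' inE => ->; rewrite orbT.
exists (G :: t'); last by move=> K; rewrite !inE et' inE orbCA.
split=> // [K|K]; rewrite et' inE => /predU1P[->|Kt]; [exact: ltnW|exact: Gt| |].
  have [v + [H Ht /subsetP sFH]] := GtF G (mem_head _ _).
  rewrite inE => /andP[vG vF].
  have [u + [H' H't sGH']] := tG H Ht; rewrite inE => /andP[uH uG].
  exists u; last by exists H'; rewrite ?sub_t'.
  rewrite inE uG andbT; apply: contra uH => uF; apply: sFH.
  by rewrite !inE uF andbT; apply: contraNneq vG => <-.
have [v vGK [H Ht sGH]] := tG K Kt.
by exists v => //; exists H; rewrite ?sub_t'.
Qed.

(** Insertion sort, where the facets being an antichain supplies the non-inclusion that each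
    insertion requires. *)
Lemma shelled_sort D t :
    shelled t -> {subset t <= facets D} ->
  exists2 t', sorted_shelled t' & t' =i t.
Proof.
elim: t => [|F t IHt] /=; first by exists [::].
move=> [tF sht] sub.
have [|t' sht' et'] := IHt sht; first by move=> G Gt; apply: sub; rewrite inE Gt orbT.
have [| |r shr er] := @sorted_shelled_insert t' F sht'.
- move=> G; rewrite et' => /tF[v vFG [H Ht sFH]].
  by exists v => //; exists H; rewrite ?et'.
- move=> G; rewrite et' => Gt; apply: contra (attaches_notin tF Gt) => sGF.
  have /facetsP[_ maxG] : G \in facets D by apply: sub; rewrite inE Gt orbT.
  have /facetsP[FD _] : F \in facets D by apply: sub; rewrite mem_head.
  by rewrite (maxG F FD sGF).
by exists r => // G; rewrite er !inE et'.
Qed.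

(** * Ridges and the 1-facet skeleton *)

Definition ridges t : seq {set V} := flatten [seq [seq F :\ v | v in F] | F <- t].

Lemma ridgesP t G :
  reflect (exists2 F, F \in t & exists2 v, v \in F & G = F :\ v) (G \in ridges t).
Proof.
apply: (iffP flatten_mapP) => [[F Ft /imageP[v vF ->]]|[F Ft [v vF ->]]].
  by exists F => //; exists v.
by exists F => //; apply/imageP; exists v.
Qed.

Lemma sub_ridge t G H :
    H \in t -> G \subset H -> (#|G| < #|H|)%N ->
  exists2 K, K \in ridges t & G \subset K.
Proof.
move=> Ht sGH ltGH.
have /properP[_ [w wH wG]] : G \proper H by rewrite properEcard sGH.
exists (H :\ w); last by rewrite subsetD1 sGH.
by apply/ridgesP; exists H => //; exists w.
Qed.

(* If [F :\ u] lies in a previous facet then it lies in a previous ridge.  So a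
   ridge [F :\ v] not contained in a previous one meets each of them inside some
   [F :\ u :\ v] with [u != v] and [F :\ u] in a previous ridge. *)
Lemma weakly_shelled_ridges t : sorted_shelled t -> weakly_shelled (ridges t).
Proof.
elim: t => //= F t IHt [leFt tF /IHt wt].
rewrite /ridges /= -/(ridges t) /image_mem.
(* Generalizing [enum F] to any list of vertices of [F] lets its ridges be added one at a time. *)
have : {subset enum F <= F} by move=> v; rewrite mem_enum.
elim: (enum F) => //= v r IHr sub_r.
have {IHr} wr : weakly_shelled ([seq F :\ u | u <- r] ++ ridges t).
  by apply: IHr => u ur; apply: sub_r; rewrite inE ur orbT.
have {sub_r} [vF rF] : v \in F /\ {subset r <= F}.
  by split=> [|u ur]; apply: sub_r; rewrite inE ?eqxx ?ur ?orbT.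
set L := _ ++ _ in wr *.
have below u : u \in F -> forall H, H \in t -> F :\ u \subset H ->
    exists2 K, K \in L & F :\ u \subset K.
  move=> uF H Ht sFH; have [|K Kt sFK] := sub_ridge Ht sFH.
    by rewrite -ltnS (card_setD1 uF) ltnS; exact: leFt.
  by exists K => //; rewrite mem_cat Kt orbT.
split=> // [G|].
  rewrite mem_cat -ltnS (card_setD1 vF) => /orP[/mapP[u /rF uF ->]|].
    by rewrite (card_setD1 uF).
  by move=> /ridgesP[H Ht [w wH ->]]; rewrite (card_setD1 wH) leFt.
case: (boolP (has (fun G => F :\ v \subset G) L)) => [/hasP|/hasPn new]; first by left.
right=> K KL; move: (KL); rewrite mem_cat => /orP[/mapP[u ur eK]|].
  (* A ridge of the same facet is its own witness. *)
  exists u; last by exists K => //; rewrite eK setSD ?subD1set.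
  rewrite eK !inE eqxx (rF u ur) !andbT /=.
  by apply: contraNneq (new K KL) => <-; rewrite eK.
move=> /ridgesP[H Ht [w wH eK]].
have [u + [H' H't sFH']] := tF H Ht; rewrite inE => /andP[uH uF].
have [M ML sFM] := below u uF H' H't sFH'.
exists u; last by exists M => //; apply: subset_trans sFM; rewrite setSD ?subD1set.
rewrite eK !inE (negPf uH) andbF uF andbT /=.
by apply: contraNneq (new M ML) => <-.
Qed.

(** A dropped face lies in a kept one, which replaces it as a witness. As sizes do not increase, a
    later face never strictly contains an earlier one, so the kept faces form an antichain. *)
Lemma weakly_shelled_prune t :
    weakly_shelled t ->
  exists t', [/\ shelled t', {subset t' <= t},
    forall G, G \in t -> exists2 H, H \in t' & G \subset H
  & forall G H, G \in t' -> H \in t' -> G \subset H -> G = H].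
Proof.
elim: t => [|F t IHt] /=; first by exists [::].
move=> [leF caseF /IHt[t' [sht' sub cover anti]]].
case: caseF => [[G Gt sFG]|tF].
  exists t'; split=> // [K /sub Kt|K]; first by rewrite inE Kt orbT.
  rewrite inE => /predU1P[->|/cover //].
  by have [H Ht' sGH] := cover G Gt; exists H => //; exact: subset_trans sGH.
have newF G : G \in t' -> ~~ (F \subset G) by move=> /sub; exact: attaches_notin.
exists (F :: t'); split=> /=.
- split=> // G /sub /tF[v vFG [H Ht sFH]]; exists v => //.
  by have [H' H't' sHH'] := cover H Ht; exists H' => //; exact: subset_trans sHH'.
- by move=> G; rewrite !inE => /predU1P[->|/sub ->]; rewrite ?eqxx ?orbT.
- move=> G; rewrite inE => /predU1P[->|/cover[H Ht' sGH]].
    by exists F; rewrite ?mem_head.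
  by exists H => //; rewrite inE Ht' orbT.
move=> G H; rewrite !inE => /predU1P[->|Gt'] /predU1P[->|Ht'] // sGH.
- by have := newF H Ht'; rewrite sGH.
- by apply/eqP; rewrite eqEcard sGH leF ?sub.
exact: anti.
Qed.

(** The faces kept by pruning generate the same complex and form an antichain, hence they are its
    facets. *)
Lemma shellable_weakly_shelled t :
  weakly_shelled t -> shellable (generated_complex [set G in t]).
Proof.
move=> /weakly_shelled_prune[t' [sht' sub cover anti]].
apply/shellableP; exists t' => // F; apply/idP/facetsP => [Ft'|[/generatedP[G]]].
  split=> [|G /generatedP[H + sGH] sFG].
    by apply/generatedP; exists F; rewrite // inE sub.
  rewrite inE => /cover[K Kt' sHK]; apply/eqP; rewrite eqEsubset sFG andbT.
  have sGK := subset_trans sGH sHK.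
  by rewrite (anti F K) ?(subset_trans sFG).
rewrite inE => /cover[H Ht' sGH] sFG maxF; rewrite -(maxF H) //.
  by apply/generatedP; exists H; rewrite // inE sub.
exact: subset_trans sGH.
Qed.

Lemma shellable_one_facet_skeleton D :
  shellable D -> shellable (one_facet_skeleton D).
Proof.
move=> /shellableP[t sht et].
have [|r shr er] := @shelled_sort D t sht; first by move=> F; rewrite et.
have := shellable_weakly_shelled (weakly_shelled_ridges shr).
congr shellable; congr generated_complex; apply/setP => G; rewrite !inE.
apply/ridgesP/exists_inP => [[F Fr [v vF ->]]|[F FD /andP[sGF /eqP cG]]].
  by exists F; rewrite -?et -?er // subD1set card_setD1 //=.
by exists F; [rewrite er et | exact: setD1_of_card].
Qed.

(** * Skeletons of pure complexes *)

Lemma exists_subset_between F G n :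
    G \subset F -> (#|G| <= n <= #|F|)%N ->
  exists2 H : {set V}, G \subset H & H \subset F /\ #|H| = n.
Proof.
move=> sGF; elim: n => [|n IHn] /andP[leGn lenF].
  by exists G => //; split=> //; apply/eqP; rewrite -leqn0.
move: leGn; rewrite leq_eqVlt => /predU1P[eG|leGn].
  by exists G.
have [|H sGH [sHF cH]] := IHn; first by rewrite -ltnS leGn ltnW.
have /properP[_ [v vF vH]] : H \proper F by rewrite properEcard sHF cH.
exists (v |: H); first by rewrite (subset_trans sGH) ?subsetUr.
by rewrite subUset sub1set vF sHF cardsU1 vH cH.
Qed.

Lemma complex_sub D F G :
  simplicial_complex D -> F \in D -> G \subset F -> G \in D.
Proof.
move=> /andP[_ /forall_inP cD] FD sGF.
by apply: (subsetP (cD F FD)); rewrite inE.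
Qed.

(** By purity a face of dimension at most [j] extends to one of dimension [j], and this to one of
    dimension [j + 1], which is a facet of the larger skeleton. *)
Lemma pure_skeletonS D (j : int) :
    simplicial_complex D -> pure_complex D -> -1 <= j -> j < complex_dim D ->
  skeleton j D = one_facet_skeleton (skeleton (j + 1) D).
Proof.
move=> cD /forall_inP pD j_ge j_lt.
(* [n] is the size of a face of dimension [j]; it is 0 for [j = -1]. *)
have [n ej] : exists n : nat, j = n%:Z - 1.
  by exists (absz (j + 1)); lia.
have extend G m : G \in D -> (#|G| <= m)%N -> (m <= n.+1)%N ->
    exists2 H : {set V}, G \subset H & H \in D /\ #|H| = m.
  move=> GD leGm lemn; have [F fF sGF] := facet_exists GD.
  have /eqP dF := pD F fF; have /facetsP[FD _] := fF.
  have [|H sGH [sHF cH]] := @exists_subset_between F G m sGF.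
    by rewrite leGm; move: dF; rewrite /face_dim; lia.
  by exists H => //; rewrite (complex_sub cD FD sHF).
have mem_sk i G : (G \in skeleton (i%:Z - 1) D) = (G \in D) && (#|G| <= i)%N.
  by rewrite inE /face_dim; congr (_ && _); lia.
have -> : j + 1 = n.+1%:Z - 1 by lia.
rewrite ej; apply/setP => G; rewrite mem_sk.
apply/andP/generatedP => [[GD leGn]|[H + sGH]].
  have [H sGH [HD cH]] := extend G n GD leGn (leqnSn n).
  have [|F sHF [FD cF]] := extend H n.+1 HD _ (leqnn _); first by rewrite cH.
  exists H => //; rewrite inE; apply/exists_inP; exists F; last by rewrite sHF cH cF /=.
  apply/facetsP; rewrite mem_sk FD cF leqnn; split=> // K.
  rewrite mem_sk => /andP[_ leK] sFK; apply/eqP.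
  by rewrite eq_sym eqEcard sFK cF.
rewrite inE => /exists_inP[F /facetsP[+ _] /andP[sHF /eqP cH]].
rewrite mem_sk => /andP[FD leF]; split.
  exact: complex_sub cD FD (subset_trans sGH sHF).
by rewrite (leq_trans (subset_leq_card sGH)) // -ltnS cH.
Qed.

Lemma shellable_pure_skeleton D (j : int) :
    simplicial_complex D -> shellable D -> pure_complex D -> -1 <= j ->
  shellable (skeleton j D).
Proof.
move=> cD shD pD j_ge.
(* Descending induction on [j], starting from [j] at least the dimension, where the skeleton is
   [D]. *)
have [n] := ubnP (absz (complex_dim D - j)).
elim: n j j_ge => // n IHn j j_ge le_n.
have [ltj|lej] := ltP j (complex_dim D).
  rewrite pure_skeletonS //; apply: shellable_one_facet_skeleton.
  by apply: IHn; lia.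
suff -> : skeleton j D = D by [].
apply/setP => F; rewrite inE; case FD: (F \in D) => //=.
apply: le_trans lej; rewrite /face_dim /complex_dim.
by rewrite lerD2r lez_nat; exact: leq_bigmax_cond.
Qed.

End FacetSkeletons.

Theorem corollary2p13 (V : finType) (Gamma : {set {set V}}) (d : int)
    (Gamma_complex : simplicial_complex Gamma)
    (Gamma_shellable : shellable Gamma)
    (dim_Gamma : complex_dim Gamma = d) :
  (forall i : nat, i%:Z <= d -> shellable (facet_skeleton i Gamma)) /\
  (pure_complex Gamma -> forall j : int, -1 <= j -> shellable (skeleton j Gamma)).
Proof.
split=> [i _|pG j]; last exact: shellable_pure_skeleton.
by elim: i => // i IHi; exact: shellable_one_facet_skeleton.
Qed.
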